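(* Let $D\subset\mathbb R^d$ be a bounded domain and let $$\log a(x,\omega)=a_0(x)+\sum_{k=1}^\infty\sigma_k\,\xi_k(\omega)\,a_k(x),\qquad x\in D,$$ converge almost surely in $L^\infty(D)$, with uncorrelated mean-zero real random variables $\xi_k$ satisfying $\operatorname{Var}[\xi_k]=1$. For $K\in\mathbb N$ let $\log a_K$ denote the random field resulting from truncating the series after $K$ terms, and let $P,P_K$ denote the distributions of $a$ and $a_K$ on $L^\infty_+(D)$, respectively. If there exists a constant $C<\infty$ such that $\mathsf E[|\xi_k|]<C$ for all $k\in\mathbb N$, then $$d_1(P,P_K)\le C\sum_{k=K+1}^\infty|\sigma_k|\,\|a_k\|_{L^\infty(D)},$$ where the Wasserstein distance is taken with respect to the metric $d(a,\tilde a)=\|\log a-\log\tilde a\|_{L^\infty(D)}$ on $L^\infty_+(D)$. In the case of bounded random coefficients, i.e., $|\xi_k|\le C$ almost surely for all $k\in\mathbb N$, one also has for any $p\ge1$ $$d_p(P,P_K)\le C\sum_{k=K+1}^\infty|\sigma_k|\,\|a_k\|_{L^\infty(D)}.$$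
   Context: $L^\infty_+(D):=\{a\in L^\infty(D)\colon\operatorname{ess\,inf}a>0\}$. Here $\sigma_k\in\mathbb R$ and $a_0,a_k\in L^\infty(D)$ are deterministic. For Borel probability measures on a metric space $(\mathcal X,d)$, $d_p(P,Q)=\inf_\pi(\iint d(x,y)^p\,\pi(dx,dy))^{1/p}$, the infimum over all Borel probability measures $\pi$ on $\mathcal X\times\mathcal X$ with marginals $P$ and $Q$. *)

(* Defs.v *)
From HB Require Import structures.
From mathcomp Require Import all_boot all_order all_algebra.
From mathcomp Require Import all_classical all_reals all_analysis.
From mathcomp Require Import ess_sup_inf measurable_realfun.

Set Implicit Arguments.
Unset Strict Implicit.
Unset Printing Implicit Defensive.
Import Order.TTheory GRing.Theory Num.Theory.
Import numFieldNormedType.Exports.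

Local Open Scope classical_set_scope.
Local Open Scope ring_scope.

#[short(type="pmetricType")]
HB.structure Definition PMetric (K : numDomainType) :=
  {M of Metric K M & Pointed M}.

(* On [X * X] this is the Borel sigma-algebra of the product topology, which for
   a nonseparable X may be larger than the product sigma-algebra. *)
Notation borel X := (g_sigma_algebraType (@open X)).

Section wasserstein.
Context (R : realType) (X : pmetricType R).
Local Open Scope ereal_scope.

Definition coupling (P Q : probability (borel X) R) :
    set (probability (borel (X * X)%type) R) :=
  [set pi | (forall A : set (borel X), measurable A ->
               pi (A `*` setT) = P A) /\
            (forall B : set (borel X), measurable B ->
               pi (setT `*` B) = Q B)].

Definition wasserstein (p : R) (P Q : probability (borel X) R) : \bar R :=
  ereal_inf [set (\int[pi]_z ((mdist (z : X * X).1 z.2) `^ p)%:E) `^ p^-1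
            | pi in coupling P Q].

End wasserstein.

Section lebesgue.
Context (R : realType) (n : nat).
Local Notation V := 'rV[R]_n.+1.

(* Closed boxes; [box b] is empty, with volume 0, as soon as one side is.  The
   dimension is positive, so that a degenerate box has volume 0. *)
Definition box (b : V * V) : set V :=
  [set x | forall i, b.1 ord0 i <= x ord0 i <= b.2 ord0 i].

Definition box_volume (b : V * V) : R :=
  \prod_(i < n.+1) Num.max 0 (b.2 ord0 i - b.1 ord0 i).

Definition lebesgue_outer (A : set V) : \bar R :=
  ereal_inf [set (\sum_(k <oo) (box_volume (B k))%:E)%E
            | B in [set B : (V * V)^nat | A `<=` \bigcup_k box (B k)]].

Lemma box_volume_ge0 b : 0 <= box_volume b.
Proof. by apply: prodr_ge0 => i _; rewrite le_max lexx. Qed.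

Let lebesgue_outer_ge0 A : (0 <= lebesgue_outer A)%E.
Proof.
apply: le_ereal_inf_tmp => _ [B _ <-]; apply: nneseries_ge0 => k _ _.
by rewrite lee_fin box_volume_ge0.
Qed.

Let le_lebesgue_outer : {homo lebesgue_outer : A B / A `<=` B >-> (A <= B)%E}.
Proof.
move=> A B AB; apply/ereal_inf_le_tmp => _ [C BC <-].
by exists C => //; exact: subset_trans BC.
Qed.

Let lebesgue_outer0 : lebesgue_outer set0 = 0%E.
Proof.
apply/eqP; rewrite eq_le lebesgue_outer_ge0 andbT.
apply: ereal_inf_lbound; exists (fun=> (0, 0)); first exact: sub0set.
apply: eseries0 => k _ _ /=; congr (_%:E); rewrite /box_volume /=.
by rewrite (bigD1 ord0)//= !mxE subrr maxxx mul0r.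
Qed.

Let lebesgue_outer_sigma_subadditive : sigma_subadditive lebesgue_outer.
Proof.
move=> A; have [[i ioo]|] := pselect (exists i, lebesgue_outer (A i) = +oo%E).
  rewrite (eseries_pinfty _ _ ioo) ?leey// => k _.
  by rewrite -ltNye (lt_le_trans _ (lebesgue_outer_ge0 _)).
rewrite -forallNE => Aoo; apply/lee_addgt0Pr => e e0.
rewrite (le_trans _ (epsilon_trick _ _ (ltW e0)))//.
pose P k (B : (V * V)^nat) := A k `<=` \bigcup_j box (B j) /\
  (\sum_(j <oo) (box_volume (B j))%:E <=
    lebesgue_outer (A k) + (e / (2 ^ k.+1)%:R)%:E)%E.
have [G PG] : {G : nat -> (V * V)^nat & forall k, P k (G k)}.
  apply: (@choice _ _ P) => k.
  have fin : lebesgue_outer (A k) \is a fin_num.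
    by rewrite ge0_fin_numE// ltey; exact/eqP/Aoo.
  have ek : 0 < e / (2 ^ k.+1)%:R by rewrite divr_gt0// ltr0n expn_gt0.
  have [_ [B AB <-] BA] := lb_ereal_inf_adherent ek fin.
  by exists B; split => //; exact: ltW.
pose v (jk : nat * nat) := (box_volume (G jk.1 jk.2))%:E.
have v0 jk : (0 <= v jk)%E by rewrite lee_fin box_volume_ge0.
apply: (@le_trans _ _ (\esum_(i in setT) v i)%E).
  have /card_esym/ppcard_eqP[f] := card_nat2.
  apply: ereal_inf_lbound; exists (fun i => G (f i).1 (f i).2) => /=.
    move=> x [k _ /(PG k).1 [j _ Gx]]; exists (f^-1%FUN (k, j)) => //.
    by rewrite invK ?inE.
  rewrite -(esum_pred_image v _ xpredT) ?[fun=> _]set_true//.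
  by rewrite image_eq.
rewrite (_ : (\esum_(i in setT) v i)%E =
             (\sum_(i <oo) \sum_(j <oo) v (i, j))%E); last first.
  pose J : nat -> set (nat * nat) := fun i => [set (i, j) | j in setT].
  rewrite (_ : setT = \bigcup_k J k); last first.
    by rewrite predeqE => -[a b]; split => // _; exists a => //; exists b.
  rewrite esum_bigcupT//; last first.
    apply/trivIsetP => i j _ _ ij; rewrite predeqE => -[k m] /=; split => //=.
    by move=> [[_] _ [<- _]] [m' _] [] /esym/eqP; rewrite (negbTE ij).
  rewrite -(image_id [set: nat]) -fun_true esum_pred_image//; last first.
    by move=> k _; exact: esum_ge0.
  apply: eq_eseriesr => /= j _.
  rewrite -(esum_pred_image v (pair j) predT)//=; last first.
    by move=> ? ? _ _; exact: (@can_inj _ _ _ snd).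
  by congr esum; rewrite predeqE => -[a b]; split; move=> [i _ <-]; exists i.
apply: lee_nneseries => [k _ _|k _]; last by have [_] := PG k.
  by apply: nneseries_ge0 => m _ _; exact: v0.
Qed.

HB.instance Definition _ := isOuterMeasure.Build R V lebesgue_outer
  lebesgue_outer0 lebesgue_outer_ge0 le_lebesgue_outer
  lebesgue_outer_sigma_subadditive.

Section restriction.
Variable D : set V.

(* Lebesgue measure restricted to D, on the space 'rV_n.+1.  When D is Lebesgue
   measurable, the Caratheodory sets of the restricted outer measure are the A
   such that [A `&` D] is Lebesgue measurable, and "almost everywhere" means
   almost everywhere in D.  Measurable functions modulo this relation are
   therefore the measurable functions on D modulo almost everywhere equality. *)
Definition lebesgue_outer_restr (A : set V) := lebesgue_outer (A `&` D).

Let restr0 : lebesgue_outer_restr set0 = 0%E.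
Proof. by rewrite /lebesgue_outer_restr set0I outer_measure0. Qed.

Let restr_ge0 A : (0 <= lebesgue_outer_restr A)%E.
Proof. exact: outer_measure_ge0. Qed.

Let le_restr : {homo lebesgue_outer_restr : A B / A `<=` B >-> (A <= B)%E}.
Proof. by move=> A B AB; apply: le_outer_measure; exact: setSI. Qed.

Let restr_sigma_subadditive : sigma_subadditive lebesgue_outer_restr.
Proof.
move=> F; rewrite /lebesgue_outer_restr setI_bigcupl.
exact: outer_measure_sigma_subadditive.
Qed.

HB.instance Definition _ := isOuterMeasure.Build R V lebesgue_outer_restr
  restr0 restr_ge0 le_restr restr_sigma_subadditive.

Definition lebesgue_on :
    {measure set (caratheodory_type lebesgue_outer_restr) -> \bar R} :=
  [the {outer_measure set V -> \bar R} of lebesgue_outer_restr]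
    : set (caratheodory_type lebesgue_outer_restr) -> \bar R.

End restriction.

Definition bounded_domain (D : set V) :=
  [/\ D !=set0, open D, connected D & bounded_set D].

End lebesgue.

(* Essentially bounded measurable functions, without passing to the quotient;
   the coefficients of the series are given by representatives. *)
Notation Linfty mu := (LfunType mu (leey 1%E)).

Section Linfty_pos.
Context d (T : measurableType d) (R : realType).
Variable mu : {measure set T -> \bar R}.

Definition Linfty_norm (f : Linfty mu) : \bar R := 'N[mu]_+oo[EFin \o f]%E.

(* Elements are classes modulo almost everywhere equality, so that [log_dist]
   below is a metric and not only a pseudometric. *)
Definition Linfty_pos : Type :=
  {f : {mfun_ mu, T >-> R} |
    `[< finite_norm mu +oo f /\ (0 < ess_inf mu (EFin \o f))%E >]}.

HB.instance Definition _ := Choice.on Linfty_pos.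

Lemma finite_norm_inftyP (f : T -> R) :
  finite_norm mu +oo f <-> exists M : R, {ae mu, forall x, `|f x| <= M}.
Proof.
rewrite /finite_norm unlock; case: ifPn => mu0; split.
- by move=> /ess_supr_bounded.
- move=> [M fM]; apply: (@le_lt_trans _ _ M%:E); last exact: ltry.
  by apply/ess_supP; apply: filterS fM => x; rewrite /= lee_fin.
- move=> _; exists 0; exists setT; split => //.
  by apply/eqP; rewrite eq_le measure_ge0 andbT leNgt.
- by move=> _; exact: ltry.
Qed.

Lemma ess_inf_gt0P (f : T -> R) :
  (0 < ess_inf mu (EFin \o f))%E <->
  exists2 m : R, 0 < m & {ae mu, forall x, m <= f x}.
Proof.
split.
  move=> f0; have := ess_inf_le mu (EFin \o f).
  move: f0; case: (ess_inf _ _) => [m|_|//].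
    by rewrite lte_fin => m0 mf; exists m => //; apply: filterS mf => x.
  move=> f1; exists 1 => //; apply: filterS f1 => x /=.
  by rewrite leye_eq.
move=> [m m0 mf]; apply: (@lt_le_trans _ _ m%:E); first by rewrite lte_fin.
by apply/ess_infP; apply: filterS mf => x; rewrite /= lee_fin.
Qed.

Lemma log_finite_norm (f : Linfty_pos) :
  finite_norm mu +oo (fun x => ln (val f x)).
Proof.
have /asboolP[/finite_norm_inftyP[M fM] /ess_inf_gt0P[m m0 mf]] := valP f.
apply/finite_norm_inftyP; exists (Num.max (ln M) (- ln m)).
apply: filterS2 fM mf => x fM mf; have f0 := lt_le_trans m0 mf.
rewrite ger0_norm ?(ltW f0)// in fM.
rewrite ler_norml lerNl 2!le_max; apply/andP; split; apply/orP.
  by right; rewrite lerN2 ler_ln// posrE.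
by left; rewrite ler_ln// posrE (lt_le_trans f0).
Qed.

Lemma log_in_Linfty (f : Linfty_pos) :
  (fun x => ln (val f x)) \in Lfun mu +oo%E.
Proof.
rewrite inE; apply/andP; split; rewrite inE /=; last exact: log_finite_norm.
by apply: measurableT_comp => //; exact: measurable_ln.
Qed.

Definition Linfty_log (f : Linfty_pos) : Linfty mu :=
  Lfun_Sub (leey 1%E) (log_in_Linfty f).

Lemma exp_in_mfun (f : Linfty mu) :
  (fun x => expR (f x)) \in @mfun _ _ T (R).
Proof.
by rewrite inE /=; apply: measurableT_comp => //; exact: measurable_expR.
Qed.

Definition Linfty_exp_class (f : Linfty mu) :
    {mfun_ mu, T >-> R} :=
  (\pi_({mfun_ mu, T >-> R}) (mfun_Sub (exp_in_mfun f)))%qT.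

Lemma Linfty_exp_classE (f : Linfty mu) :
  {ae mu, forall x, Linfty_exp_class f x = expR (f x)}.
Proof.
set g := mfun_Sub (exp_in_mfun f).
have /eqmodP/asboolP : (repr (Linfty_exp_class f) = g
    %[mod {mfun_ mu, T >-> R}])%qT by rewrite reprK.
by apply: filterS => x /(_ I).
Qed.

Lemma Linfty_exp_subproof (f : Linfty mu) :
  `[< finite_norm mu +oo (Linfty_exp_class f) /\
      (0 < ess_inf mu (EFin \o Linfty_exp_class f))%E >].
Proof.
have /finite_norm_inftyP[M fM] := @Lfunction_finite _ _ _ _ _ _ f.
have eE := Linfty_exp_classE f.
apply/asboolP; split.
  apply/finite_norm_inftyP; exists (expR M); apply: filterS2 fM eE => x fM ->.
  by rewrite ger0_norm ?expR_ge0// ler_expR (le_trans (ler_norm _)).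
apply/ess_inf_gt0P; exists (expR (- M)); first exact: expR_gt0.
apply: filterS2 fM eE => x fM ->.
by rewrite ler_expR lerNl (le_trans _ fM)// -normrN ler_norm.
Qed.

Definition Linfty_exp (f : Linfty mu) : Linfty_pos :=
  exist _ (Linfty_exp_class f) (Linfty_exp_subproof f).

Lemma Linfty_expK (f : Linfty mu) :
  {ae mu, forall x, Linfty_log (Linfty_exp f) x = f x}.
Proof. by apply: filterS (Linfty_exp_classE f) => x /= ->; rewrite expRK. Qed.

Lemma Linfty_normE (f : Linfty mu) :
  ((fine (Linfty_norm f))%:E = Linfty_norm f)%E.
Proof. exact: finite_norm_fine. Qed.

Lemma eq_Linfty_norm (f g : Linfty mu) :
  {ae mu, forall x, f x = g x} -> Linfty_norm f = Linfty_norm g.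
Proof.
move=> fg; rewrite /Linfty_norm unlock; case: ifPn => // _; apply: eq_ess_sup.
by apply: filterS fg => x /= ->.
Qed.

Lemma le_Linfty_normD (f g : Linfty mu) :
  (fine (Linfty_norm (f + g)) <= fine (Linfty_norm f) + fine (Linfty_norm g))%R.
Proof. exact: ler_LnormD. Qed.

Definition log_dist (f g : Linfty_pos) : R :=
  fine (Linfty_norm (Linfty_log f - Linfty_log g)).

Let log_distxx f : log_dist f f = 0.
Proof. by rewrite /log_dist subrr /Linfty_norm Lnorm0. Qed.

Let log_dist_positivity f g : log_dist f g = 0 -> f = g.
Proof.
move=> /fine_Lnormr_eq0 fg; apply: val_inj; rewrite -[val f]reprK -[val g]reprK.
apply/eqmodP/asboolP.
have /asboolP[_ /ess_inf_gt0P[m m0 mf]] := valP f.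
have /asboolP[_ /ess_inf_gt0P[m' m'0 mg]] := valP g.
apply: filterS3 fg mf mg => x /(_ I) /= fg mf mg _.
apply: ln_inj; rewrite ?posrE ?(lt_le_trans m0 mf) ?(lt_le_trans m'0 mg)//.
by apply/eqP; rewrite -subr_eq0; exact/eqP.
Qed.

Let log_dist_sym f g : log_dist f g = log_dist g f.
Proof. by rewrite /log_dist -opprB; exact: LnormrN. Qed.

Let log_dist_triangle g f h : log_dist f h <= log_dist f g + log_dist g h.
Proof.
rewrite /log_dist.
have -> : Linfty_log f - Linfty_log h =
  (Linfty_log f - Linfty_log g) + (Linfty_log g - Linfty_log h).
  by rewrite addrA subrK.
exact: le_Linfty_normD.
Qed.

HB.instance Definition _ := isMetric.Build R Linfty_pos
  log_distxx log_dist_positivity log_dist_sym log_dist_triangle.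

HB.instance Definition _ := isPointed.Build Linfty_pos (Linfty_exp 0).

End Linfty_pos.

Section truncation.
Context d (T : measurableType d) (R : realType).
Variables (mu : {measure set T -> \bar R}).
Variables (sigma : nat -> R) (a0 : Linfty mu) (a : nat -> Linfty mu).

Definition log_partial_sum (x : nat -> R) (K : nat) : Linfty mu :=
  a0 + \sum_(1 <= k < K.+1) (sigma k * x k) *: a k.

Let c k := `|sigma k| * fine (Linfty_norm (a k)).

Let c_ge0 k : 0 <= c k.
Proof. by rewrite mulr_ge0// fine_ge0// Lnorm_ge0. Qed.

Lemma Linfty_norm_sum_le (m n : nat) (x : nat -> R) :
  fine (Linfty_norm (\sum_(m <= k < n) (sigma k * x k) *: a k)) <=
  \sum_(m <= k < n) `|x k| * c k.
Proof.
elim/big_rec2: _ => [|k s f _ fs]; first by rewrite /Linfty_norm Lnorm0.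
apply: le_trans (le_Linfty_normD _ _) _; apply: lerD => //.
rewrite /c mulrA -normrM [x k * _]mulrC -lee_fin EFinM !Linfty_normE.
by rewrite -LnormZ.
Qed.

Lemma mdist_exp (f g : Linfty mu) :
  mdist (Linfty_exp f) (Linfty_exp g) = fine (Linfty_norm (f - g)).
Proof.
congr fine; apply: eq_Linfty_norm.
by apply: filterS2 (Linfty_expK f) (Linfty_expK g) => x fE gE /=; congr (_ - _).
Qed.

Context d' (Omega : measurableType d') (xi : nat -> {mfun Omega >-> R}).

Definition truncated_field (K : nat) (w : Omega) : borel (Linfty_pos mu) :=
  Linfty_exp (log_partial_sum (xi^~ w) K).

Let F (x : nat -> R) K : Linfty_pos mu := Linfty_exp (log_partial_sum x K).

Let mdist_F x y K :
  mdist (F x K) (F y K) <= \sum_(1 <= k < K.+1) `|x k - y k| * c k.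
Proof.
rewrite mdist_exp /log_partial_sum opprD addrACA subrr add0r -sumrB.
under eq_bigr do rewrite -scalerBl -mulrBr.
exact: Linfty_norm_sum_le.
Qed.

Let approx (x : nat -> R) K (e : R) : 0 < e -> exists q : seq rat,
  \sum_(1 <= k < K.+1) `|x k - ratr (nth 0 q k)| * c k < e.
Proof.
move=> e0; pose b k := e / K.+1%:R / (c k + 1).
have c1 k : 0 < c k + 1 by rewrite ltr_wpDl.
have b0 k : 0 < b k by rewrite !divr_gt0.
have /choice[q qP] k : exists q : rat, `|x k - ratr q| < b k.
  have [q qx] := @rat_in_itvoo R (x k - b k) (x k + b k) (ltac:(
    by rewrite ltrBlDr -addrA ltrDl addr_gt0)).
  by rewrite in_itv/= in qx; exists q; rewrite distrC ltr_distl.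
exists (mkseq q K.+1).
apply: (@le_lt_trans _ _ (\sum_(1 <= k < K.+1) (e / K.+1%:R))); last first.
  rewrite sumr_const_nat subn1 /= -[_ *+ _]mulr_natr -[ltLHS]mulrA gtr_pMr//.
  by rewrite mulrC ltr_pdivrMr// mul1r ltr_nat.
rewrite !big_nat; apply: ler_sum => k /andP[_ kK].
rewrite nth_mkseq// (le_trans (ler_wpM2r (c_ge0 k) (ltW (qP k))))//.
rewrite /b -[leLHS]mulrA ler_piMr ?divr_ge0 ?(ltW e0)//.
by rewrite mulrC ler_pdivrMr// mul1r lerDl.
Qed.

Lemma truncated_field_measurable (K : nat) :
  measurable_fun setT (truncated_field K).
Proof.
apply: (@measurability _ _ Omega (borel (Linfty_pos mu)) setT _
  (@open (Linfty_pos mu))) => // _ [U oU <-].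
rewrite setTI.
pose S (x : nat -> R) (y : nat -> R) :=
  \sum_(1 <= k < K.+1) `|x k - y k| * c k.
pose Q (q : seq rat) k : R := ratr (nth 0 q k).
pose A (qr : seq rat * rat) : set Omega :=
  [set w | ball (F (Q qr.1) K) (ratr qr.2) `<=` U /\
           S (xi^~ w) (Q qr.1) < ratr qr.2].
have mA qr : measurable (A qr).
  have [bU|bU] := pselect (ball (F (Q qr.1) K) (ratr qr.2) `<=` U); last first.
    by rewrite (_ : A qr = set0)//; apply/seteqP; split => // w [].
  rewrite (_ : A qr = (fun w => S (xi^~ w) (Q qr.1)) @^-1` `]-oo, ratr qr.2[).
    rewrite -[X in measurable X]setTI.
    have : measurable_fun setT (fun w => S (xi^~ w) (Q qr.1)).
      apply: measurable_sum => k; apply: measurable_funM => //.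
      by apply: measurableT_comp => //; exact: measurable_funB.
    by apply => //; exact: measurable_itv.
  by apply/seteqP; split => w /=; rewrite in_itv/=; [case|split].
rewrite (_ : _ @^-1` _ = \bigcup_qr A qr); last first.
  apply/seteqP; split => w /=.
    move=> UF; have : nbhs (F (xi^~ w) K) U by exact: open_nbhs_nbhs.
    rewrite -nbhs_ballE => -[e /= e0 eU].
    have e20 : 0 < e / 2 by rewrite divr_gt0.
    have [r /=] := @rat_in_itvoo R 0 (e / 2) e20.
    rewrite in_itv/= => /andP[r0 re].
    have [q Sq] := approx (xi^~ w) K r0.
    exists (q, r) => //; split => //= y qy; apply: eU.
    move: qy; rewrite !ballEmdist /= => qy.
    apply: le_lt_trans (metric_triangle _ (F (Q q) K) _) _.
    rewrite [e]splitr ltrD//; last exact: lt_trans qy re.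
    by apply: le_lt_trans (mdist_F _ _ _) _; exact: lt_trans Sq re.
  move=> [[q r] _ [/= bU Sr]]; apply: bU; rewrite ballEmdist /= metric_sym.
  exact: le_lt_trans (mdist_F _ _ _) Sr.
rewrite (_ : \bigcup_qr A qr =
    \bigcup_k (if unpickle k is Some qr then A qr else set0)).
  by apply: bigcupT_measurable => k; case: unpickle.
apply/seteqP; split => [w [qr _ Aw]|w [k _]].
  by exists (pickle qr) => //; rewrite pickleK.
by case: unpickle => // qr Aw; exists qr.
Qed.

HB.instance Definition _ (K : nat) := isMeasurableFun.Build _ _ _ _
  (truncated_field K) (truncated_field_measurable K).

End truncation.

(* Main.v *)
Require Import Defs.
From mathcomp Require Import all_boot all_order all_algebra.
From mathcomp Require Import all_classical all_reals all_analysis.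
From mathcomp Require Import measurable_realfun.

(** Both fields live on the same probability space, so the joint law of
    [(a, a_K)] is a coupling of their distributions and bounds the Wasserstein
    distance: [d_p(P, P_K) <= E[d(a, a_K) ^ p] ^ (1/p)]
    ([wasserstein_distribution_le]).  Pathwise, the triangle inequality through
    a later partial sum, followed by the passage to the limit, gives
    [d(a, a_K) <= \sum_(k > K) |xi_k| |sigma_k| |a_k|_oo] almost surely
    ([mdist_partial_sum_tail]).  Integrating this series term by term yields
    the bound for [d_1]; if moreover [|xi_k| <= C] almost surely, then
    [d(a, a_K)] is itself almost surely at most the claimed bound, and so are
    all its [L^p] norms.

    The delicate point is that the joint law must be defined on the Borel sets
    of the product [X * X].  Since [X], the functions of L^oo with positive
    essential infimum, is not separable, these may be more than the product sigma-algebra, and the pair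
    of two Borel random elements need not be Borel.  It is Borel as soon as one
    of them has separable range ([measurable_pair_separable]), and [a_K] does:
    it is a continuous function of the finitely many reals
    [xi_1, ..., xi_K], which rationals approximate ([partial_sum_separable]). *)

Set Implicit Arguments.
Unset Strict Implicit.
Unset Printing Implicit Defensive.
Import Order.TTheory GRing.Theory Num.Theory.
Import numFieldNormedType.Exports.

Local Open Scope classical_set_scope.
Local Open Scope ring_scope.

(** * Borel measurability on the square of a metric space *)

Lemma continuous_mdist (R : realType) (X : metricType R) :
  continuous (fun z : X * X => mdist z.1 z.2).
Proof.
move=> -[x y]; apply/cvgrPdist_lt => e e0.
have e2 : 0 < e / 2 by rewrite divr_gt0.
exists (ball x (e / 2), ball y (e / 2)).
  by split; exact: nbhsx_ballx.
move=> [x' y'] /= []; rewrite !ballEmdist /= => xx' yy'.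
rewrite ltr_norml; apply/andP; split.
  rewrite ltrBrDr -ltrBrDl opprK.
  apply: le_lt_trans (metric_triangle _ x _) _.
  apply: le_lt_trans (lerD (lexx _) (metric_triangle _ y _)) _.
  by rewrite (metric_sym x') addrCA ltrD2l [e]splitr ltrD.
rewrite ltrBlDr.
apply: le_lt_trans (metric_triangle _ x' _) _.
apply: le_lt_trans (lerD (lexx _) (metric_triangle _ y' _)) _.
by rewrite (metric_sym y') addrCA addrC ltrD2r [e]splitr ltrD.
Qed.

Lemma open_mdist_ball (R : realType) (X : metricType R) (x : X) (e : R) :
  open [set y | mdist x y < e].
Proof.
rewrite openE => y /= xy; apply/nbhs_ballP; exists (e - mdist x y) => /=.
  by rewrite subr_gt0.
move=> z; rewrite ballEmdist /= ltrBrDl; apply: le_lt_trans.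
exact: metric_triangle.
Qed.

Lemma measurable_mdist (R : realType) (X : pmetricType R) :
  measurable_fun [set: borel (X * X)%type] (fun z => mdist z.1 z.2).
Proof.
apply: (measurability _ (RGenOpens.measurableE R)) => _ [_ [a [b ->]] <-].
rewrite setTI; apply: sub_sigma_algebra => /=.
have /continuousP := @continuous_mdist R X; apply.
exact: interval_open.
Qed.

(** An open [U] of [X * X] is a union of rectangles [V * B] with [B] a ball of
    small radius centred at some [q j] and [V] open, up to points whose second
    coordinate is away from the closure of the range of [q].  Countably many
    balls suffice, so that the preimage of [U] is a countable union of
    measurable sets.  That the values of [f] need not be separable is no
    obstacle: [V] is taken as the largest open set with [V * B] included in
    [U], so that one [V] per ball is enough. *)
Lemma measurable_pair_separable d (T : measurableType d) (R : realType)
    (X : pmetricType R) (f g : T -> borel X) (q : nat -> X) :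
    measurable_fun setT f -> measurable_fun setT g ->
    (forall t e, 0 < e -> exists j, mdist (q j) (g t : X) < e) ->
  measurable_fun setT (fun t => (f t, g t) : borel (X * X)%type).
Proof.
move=> mf mg dense_q.
apply: (@measurability _ _ T (borel (X * X)%type) setT _
  (@open (X * X)%type)) => // _ [U oU <-].
rewrite setTI.
pose r m : R := m.+1%:R^-1.
pose V j m : set X := ([set x | forall y, mdist (q j) y < r m -> U (x, y)])°.
pose A jm : set T :=
  f @^-1` (V jm.1 jm.2) `&` g @^-1` [set y | mdist (q jm.1) (y : X) < r jm.2].
have mA jm : measurable (A jm).
  apply: measurableI; rewrite -[X in measurable X]setTI.
    by apply: mf => //; apply: sub_sigma_algebra; exact: open_interior.
  apply: mg => //; apply: sub_sigma_algebra => /=.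
  exact: open_mdist_ball.
rewrite (_ : _ @^-1` _ = \bigcup_j \bigcup_m A (j, m)).
  by do 2!apply: bigcupT_measurable => ?; exact: mA.
apply/seteqP; split => t /=; last first.
  by move=> [j _ [m _ [/= /interior_subset]]]; exact.
move=> Ut; have : nbhs ((f t, g t) : X * X) U by exact: open_nbhs_nbhs.
move=> /nbhs_ballP[e /= e0 eU].
have [m me] : exists m, r m < e / 2.
  have /ltr_add_invr[m] : 0 < e / 2 by rewrite divr_gt0.
  by rewrite add0r; exists m.
have [j qj] := dense_q t (r m) ltac:(by rewrite invr_gt0).
exists j => //; exists m => //; split => //=.
apply/nbhs_ballP; exists e => //= x fx y qy; apply: eU; split => //=.
rewrite ballEmdist /=.
apply: le_lt_trans (metric_triangle _ (q j) _) _.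
by rewrite metric_sym [e]splitr ltrD// (lt_trans _ me).
Qed.

Lemma measurable_mdist_pair d (T : measurableType d) (R : realType)
    (X : pmetricType R) (f g : T -> borel X) (q : nat -> X) :
    measurable_fun setT f -> measurable_fun setT g ->
    (forall t e, 0 < e -> exists j, mdist (q j) (g t : X) < e) ->
  measurable_fun setT (fun t => mdist (f t : X) (g t : X)).
Proof.
move=> mf mg dense_q.
exact: (measurableT_comp (@measurable_mdist R X)
  (measurable_pair_separable mf mg dense_q)).
Qed.

(** * Bounding the Wasserstein distance by the joint law *)

(** The joint law of two random elements on the same probability space is one
    of the couplings over which the infimum is taken. *)
Lemma wasserstein_distribution_le (R : realType) (X : pmetricType R)
    (d : measure_display) (T : measurableType d) (P : probability T R)
    (f g : {RV P >-> borel X}) (q : nat -> X) (p : R) :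
    (forall t e, 0 < e -> exists j, mdist (q j) (g t : X) < e) ->
  (wasserstein p (distribution P f) (distribution P g) <=
   (\int[P]_t (mdist (f t : X) (g t : X) `^ p)%:E) `^ p^-1)%E.
Proof.
move=> dense_q.
have mfg := measurable_pair_separable (measurable_funPT f)
  (measurable_funPT g) dense_q.
pose fg : {mfun T >-> borel (X * X)%type} := mfun_Sub (mem_set mfg).
apply: ereal_inf_lbound; exists (distribution P fg).
  by split => A mA; rewrite /= /distribution /pushforward /=;
    congr (P _); apply/seteqP; split => t //= -[].
congr (_ `^ _)%E.
rewrite ge0_integral_distribution//; last by move=> z; rewrite lee_fin powR_ge0.
apply/measurable_EFinP.
apply: (measurableT_comp (measurable_powR p)).
exact: measurable_mdist.
Qed.

(** An almost sure bound on the distance bounds all its [L^p] norms at once,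
    the law of the pair having total mass 1. *)
Lemma wasserstein_le_ae (R : realType) (X : pmetricType R)
    (d : measure_display) (T : measurableType d) (P : probability T R)
    (f g : {RV P >-> borel X}) (q : nat -> X) (p M : R) :
    (forall t e, 0 < e -> exists j, mdist (q j) (g t : X) < e) ->
    0 < p -> 0 <= M -> {ae P, forall t, mdist (f t : X) (g t : X) <= M} ->
  (wasserstein p (distribution P f) (distribution P g) <= M%:E)%E.
Proof.
move=> dense_q p0 M0 fgM.
apply: (le_trans (wasserstein_distribution_le f p dense_q)).
have -> : (M%:E = (\int[P]_t (cst (M `^ p)%:E) t) `^ p^-1)%E.
  rewrite integral_cst//= [X in (_ * X)%E](_ : _ = 1%E); last first.
    exact: probability_setT.
  rewrite mule1 poweR_EFin -powRrM divff ?gt_eqF//.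
  by rewrite powRr1.
have fg0 t : (0 <= (mdist (f t : X) (g t : X) `^ p)%:E)%E.
  by rewrite lee_fin powR_ge0.
apply: gt0_ler_poweR.
- by rewrite invr_ge0 ltW.
- by rewrite in_itv /= leey andbT; exact: integral_ge0.
- rewrite in_itv /= leey andbT.
  by apply: integral_ge0 => t _; rewrite lee_fin powR_ge0.
- apply: ae_ge0_le_integral => //.
  + apply/measurable_EFinP; apply: (measurableT_comp (measurable_powR p)).
    exact: measurable_mdist_pair dense_q.
  + by move=> t _; rewrite lee_fin powR_ge0.
  + apply: filterS fgM => t fgM _; rewrite /= lee_fin.
    by apply: ge0_ler_powR; rewrite ?nnegrE ?mdist_ge0// ltW.
Qed.

Lemma wasserstein1_le (R : realType) (X : pmetricType R)
    (d : measure_display) (T : measurableType d) (P : probability T R)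
    (f g : {RV P >-> borel X}) (q : nat -> X) (h : T -> \bar R) :
    (forall t e, 0 < e -> exists j, mdist (q j) (g t : X) < e) ->
    measurable_fun setT h -> (forall t, (0 <= h t)%E) ->
    {ae P, forall t, ((mdist (f t : X) (g t : X))%:E <= h t)%E} ->
  (wasserstein 1 (distribution P f) (distribution P g) <= \int[P]_t h t)%E.
Proof.
move=> dense_q mh h0 fgh.
apply: (le_trans (wasserstein_distribution_le f 1 dense_q)).
under eq_integral do rewrite powRr1 ?mdist_ge0//.
rewrite invr1 poweRe1; last first.
  by apply: integral_ge0 => t _; rewrite lee_fin mdist_ge0.
apply: ae_ge0_le_integral => //.
- by move=> t _; rewrite lee_fin mdist_ge0.
- by apply/measurable_EFinP; exact: measurable_mdist_pair dense_q.
- by apply: filterS fgh => t + _.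
Qed.

(** * Partial sums of the logarithmic expansion *)

Lemma mdist_Linfty_exp d (T : measurableType d) (R : realType)
    (mu : {measure set T -> \bar R}) (f : Linfty_pos mu) (g : Linfty mu) :
  mdist f (Linfty_exp g) = fine (Linfty_norm (Linfty_log f - g)).
Proof.
congr fine; apply: eq_Linfty_norm.
by apply: filterS (Linfty_expK g) => x /= gE; congr (_ - _).
Qed.

Lemma fine_Linfty_norm_ge0 d (T : measurableType d) (R : realType)
    (mu : {measure set T -> \bar R}) (f : Linfty mu) :
  0 <= fine (Linfty_norm f).
Proof. by rewrite fine_ge0// Lnorm_ge0. Qed.

Lemma mdist_partial_sum_le d (T : measurableType d) (R : realType)
    (mu : {measure set T -> \bar R}) (sigma : nat -> R) (a0 : Linfty mu)
    (a : nat -> Linfty mu) (x y : nat -> R) (K : nat) :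
  mdist (Linfty_exp (log_partial_sum sigma a0 a x K))
        (Linfty_exp (log_partial_sum sigma a0 a y K)) <=
  \sum_(1 <= k < K.+1) `|x k - y k| * (`|sigma k| * fine (Linfty_norm (a k))).
Proof.
rewrite mdist_exp /log_partial_sum opprD addrACA subrr add0r -sumrB.
under eq_bigr do rewrite -scalerBl -mulrBr.
exact: Linfty_norm_sum_le.
Qed.

(** The countable family is the one of the partial sums with rational
    coordinates, stored in finite sequences so as to be enumerated by [nat]. *)
Lemma partial_sum_separable d (T : measurableType d) (R : realType)
    (mu : {measure set T -> \bar R}) (sigma : nat -> R) (a0 : Linfty mu)
    (a : nat -> Linfty mu) (K : nat) :
  exists q : nat -> Linfty_pos mu, forall (x : nat -> R) e, 0 < e ->
    exists j, mdist (q j) (Linfty_exp (log_partial_sum sigma a0 a x K)) < e.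
Proof.
pose Q (s : seq rat) k : R := ratr (nth 0 s k).
pose q j := Linfty_exp (log_partial_sum sigma a0 a
  (Q (odflt [::] (unpickle j))) K).
exists q => x e e0.
pose c k := `|sigma k| * fine (Linfty_norm (a k)).
have c0 k : 0 <= c k by rewrite mulr_ge0// fine_Linfty_norm_ge0.
pose S := \sum_(1 <= k < K.+1) c k.
have S0 : 0 <= S by exact: sumr_ge0.
(* [S] may vanish: dividing by [S + 1] avoids a case distinction. *)
have S1 : 0 < S + 1 by rewrite ltr_wpDl.
have b0 : 0 < e / (S + 1) by rewrite divr_gt0.
have /choice[r rP] k : exists r : rat, `|ratr r - x k| < e / (S + 1).
  have [r] := @rat_in_itvoo R (x k - e / (S + 1)) (x k + e / (S + 1))
    (ltac:(by rewrite ltrBlDr -addrA ltrDl addr_gt0)).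
  by rewrite in_itv/= => rx; exists r; rewrite ltr_distl.
exists (pickle (mkseq r K.+1)); rewrite /q pickleK /=.
apply: le_lt_trans (mdist_partial_sum_le _ _ _ _ _ _) _.
apply: (@le_lt_trans _ _ (e / (S + 1) * S)).
  rewrite mulr_sumr !big_nat; apply: ler_sum => k /andP[_ kK].
  apply: ler_wpM2r; first exact: c0.
  by rewrite /Q (nth_mkseq 0 r kK) ltW.
by rewrite -mulrA gtr_pMr// mulrC ltr_pdivrMr// mul1r ltrDl.
Qed.

(** Going through the partial sum of order [N >= K] costs its distance to
    [Linfty_log f], which vanishes as [N] grows, plus a finite section of the
    tail on the right. *)
Lemma mdist_partial_sum_tail d (T : measurableType d) (R : realType)
    (mu : {measure set T -> \bar R}) (sigma : nat -> R) (a0 : Linfty mu)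
    (a : nat -> Linfty mu) (f : Linfty_pos mu) (x : nat -> R) (K : nat) :
  Linfty_norm (Linfty_log f - log_partial_sum sigma a0 a x N)
    @[N --> \oo] --> 0%E ->
  ((mdist f (Linfty_exp (log_partial_sum sigma a0 a x K)))%:E <=
   \sum_(K.+1 <= k <oo) `|x k|%:E * (`|sigma k|%:E * Linfty_norm (a k)))%E.
Proof.
move=> f_cvg; rewrite mdist_Linfty_exp.
(* The bound is read as the limit in [N] of the distance of [Linfty_log f] to
   the partial sum of order [N], plus the tail. *)
set t := (leRHS); rewrite -[t]add0e.
have t0 : (0 <= t)%E.
  by apply: nneseries_ge0 => k _ _; rewrite !mule_ge0// Lnorm_ge0.
have [->|tfin] := eqVneq t +oo%E; first by rewrite addey// leey.
have {}tfin : t \is a fin_num by rewrite ge0_fin_numE// ltey.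
apply: (@cvge_ge _ \oo _ _ (fun N =>
  Linfty_norm (Linfty_log f - log_partial_sum sigma a0 a x N)%R + t)%E);
  last first.
  apply: cvgeD; [exact: fin_num_adde_defl|exact: f_cvg|exact: cvg_cst].
near=> N; have KN : (K <= N)%N by near: N; exact: nbhs_infty_ge.
have -> : Linfty_log f - log_partial_sum sigma a0 a x K =
  (Linfty_log f - log_partial_sum sigma a0 a x N) +
  \sum_(K.+1 <= k < N.+1) (sigma k * x k) *: a k.
  rewrite /log_partial_sum (@big_cat_nat _ _ _ K.+1 1 N.+1)//=.
  by rewrite !opprD !addrA subrK.
apply: (@le_trans _ _ (fine (Linfty_norm (Linfty_log f -
  log_partial_sum sigma a0 a x N)) + fine (Linfty_norm
  (\sum_(K.+1 <= k < N.+1) (sigma k * x k) *: a k)))%:E).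
  by rewrite lee_fin; exact: le_Linfty_normD.
rewrite EFinD Linfty_normE leeD2l//.
apply: (@le_trans _ _ (\sum_(K.+1 <= k < N.+1)
   `|x k|%:E * (`|sigma k|%:E * Linfty_norm (a k)))%E); last first.
  by apply: nneseries_lim_ge => k _ _; rewrite !mule_ge0// Lnorm_ge0.
under [X in (_ <= X)%E]eq_bigr do rewrite -Linfty_normE -!EFinM.
by rewrite sumEFin lee_fin; exact: Linfty_norm_sum_le.
Unshelve. all: by end_near. Qed.

Theorem proposition3p14 (R : realType) (n : nat) (D : set 'rV[R]_n.+1)
    (hD : bounded_domain D)
    (d : measure_display) (Omega : measurableType d) (Pr : probability Omega R)
    (sigma : nat -> R) (xi : nat -> {RV Pr >-> R})
    (a0 : Linfty (lebesgue_on D)) (a_ : nat -> Linfty (lebesgue_on D))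
    (a : {RV Pr >-> borel (Linfty_pos (lebesgue_on D))})
    (mean0 : forall k, (0 < k)%N -> ('E_Pr[xi k] = 0)%E)
    (var1 : forall k, (0 < k)%N -> ('V_Pr[xi k] = 1)%E)
    (uncorrelated : forall j k, (0 < j)%N -> (0 < k)%N -> j != k ->
       covariance Pr (xi j) (xi k) = 0%E)
    (series : {ae Pr, forall w,
       Linfty_norm (Linfty_log (a w) - log_partial_sum sigma a0 a_ (xi^~ w) N)
         @[N --> \oo] --> 0%E})
    (K : nat) :
  (forall C : R,
     (forall k, (0 < k)%N -> ('E_Pr[(fun w => `|xi k w|%R)] < C%:E)%E) ->
     (wasserstein 1 (distribution Pr a)
        (distribution Pr (truncated_field sigma a0 a_ xi K)) <=
      C%:E * \sum_(K.+1 <= k <oo) (`|sigma k|%:E * Linfty_norm (a_ k)))%E) /\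
  (forall C : R,
     (forall k, (0 < k)%N -> {ae Pr, forall w, `|xi k w| <= C}) ->
     forall p : R, 1 <= p ->
     (wasserstein p (distribution Pr a)
        (distribution Pr (truncated_field sigma a0 a_ xi K)) <=
      C%:E * \sum_(K.+1 <= k <oo) (`|sigma k|%:E * Linfty_norm (a_ k)))%E).
Proof.
pose X := Linfty_pos (lebesgue_on D).
pose aK : {RV Pr >-> borel X} := truncated_field sigma a0 a_ xi K.
pose w k : \bar R := (`|sigma k|%:E * Linfty_norm (a_ k))%E.
have w0 k : (0 <= w k)%E by rewrite mule_ge0// Lnorm_ge0.
have [q0 q0P] := partial_sum_separable sigma a0 a_ K.
have dense_q t e : 0 < e -> exists j, mdist (q0 j) (aK t : X) < e.
  exact: q0P.
have tail : {ae Pr, forall t, ((mdist (a t : X) (aK t : X))%:E <=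
    \sum_(K.+1 <= k <oo) `|xi k t|%:E * w k)%E}.
  by apply: filterS series => t; exact: mdist_partial_sum_tail.
split=> C xiC.
- have mF k : measurable_fun setT (fun t => (`|xi k t|%:E * w k)%E).
    rewrite /w -Linfty_normE -EFinM; under eq_fun do rewrite -EFinM.
    apply/measurable_EFinP; apply: measurable_funM => //.
    exact: measurableT_comp.
  have F0 k t : (0 <= `|xi k t|%:E * w k)%E by rewrite mule_ge0.
  apply: le_trans (wasserstein1_le dense_q _ _ tail) _.
  + under eq_fun do rewrite eseries_cond.
    by apply: ge0_emeasurable_sum => *.
  + by move=> t; apply: nneseries_ge0.
  + under eq_integral do rewrite eseries_cond eseries_mkcond.
    rewrite integral_nneseries//=;
      [|by move=> k; case: (K < k)%N|by move=> k t _; case: ifP].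
    rewrite -nneseriesZl; last by move=> k _; exact: w0.
    rewrite [leRHS]eseries_cond [leRHS]eseries_mkcond.
    apply: lee_nneseries => [k _ _|k _].
      by apply: integral_ge0 => t _; case: ifP.
    rewrite /=; case: ltnP => Kk; last by rewrite integral0.
    rewrite /w -Linfty_normE -EFinM.
    under eq_integral do rewrite muleC.
    rewrite ge0_integralZl_EFin//=;
      [|by apply/measurable_EFinP; exact: measurableT_comp
       |by rewrite mulr_ge0// fine_Linfty_norm_ge0].
    rewrite muleC lee_wpmul2r ?lee_fin ?mulr_ge0 ?fine_Linfty_norm_ge0//.
    have /ltW := xiC k (leq_trans (ltn0Sn K) Kk).
    by rewrite unlock.
- move=> p p1.
  have {}xiC : {ae Pr, forall t k, (0 < k)%N -> `|xi k t| <= C}.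
    have xiC' k : {ae Pr, forall t, (0 < k)%N -> `|xi k t| <= C}.
      case: k => [|k]; first exact: aeW.
      by apply: filterS (xiC k.+1 isT) => t + _.
    exact: ae_foralln xiC'.
  (* An almost sure event of a probability space is nonempty. *)
  have C0 : 0 <= C.
    have Pr_proper : ProperFilter (almost_everywhere Pr).
      apply: ae_properfilter_algebraOfSetsType.
      by rewrite [ltRHS](_ : _ = 1%E) ?lte01//; exact: probability_setT.
    have [t /(_ 1%N isT)] := filter_ex xiC.
    exact: le_trans.
  rewrite -nneseriesZl; last by move=> k _; exact: w0.
  set M := (leRHS).
  have M0 : (0 <= M)%E.
    apply: nneseries_ge0 => k _ _.
    by apply: mule_ge0; [rewrite lee_fin|exact: w0].
  (* The bound is moved inside the series, [C%:E * +oo] being 0 when [C] is: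
     then the tail vanishes termwise even if the series of the norms diverges. *)
  have [->|Moo] := eqVneq M +oo%E; first exact: leey.
  have Mfin : M \is a fin_num by rewrite ge0_fin_numE// ltey.
  rewrite -(fineK Mfin); apply: (wasserstein_le_ae dense_q).
  + exact: lt_le_trans p1.
  + by rewrite fine_ge0.
  + apply: filterS2 tail xiC => t tail_t xiC_t.
    rewrite -lee_fin (fineK Mfin); apply: le_trans tail_t _.
    rewrite /M eseries_cond [leRHS]eseries_cond.
    apply: lee_nneseries => [k _ _|k /= Kk].
      by apply: mule_ge0; [rewrite lee_fin|exact: w0].
    apply: lee_wpmul2r; first exact: w0.
    by rewrite lee_fin xiC_t// (leq_trans _ Kk).
Qed.
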